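(* Let $\mathcal P$ be any one of the ten resolving terms ''$p$-L'', ''$p$-R'', ''$q$-R'', ''$q$-L'', ''LR'', ''RL'', ''LL'', ''RR'', ''$p$-biresolving'', ''$q$-biresolving''. Then an endomorphism $\varphi$ of a subshift $(X,\sigma)$ is directionally essentially weakly $\mathcal P$ if and only if it is essentially weakly $\mathcal P$.
   Context: **Subshifts.** An alphabet is a finite set with at least two elements. For an alphabet $A$, $A^{\mathbb Z}$ carries the product topology; the shift maps $(a_j)_j$ to $(a_{j+1})_j$. A subshift $(X,\sigma)$ over $A$ is a closed $X\subset A^{\mathbb Z}$ with $\sigma(X)=X$, $\sigma$ being the restricted shift. An endomorphism of a dynamical system $(X,\tau)$ is a continuous map $X\to X$ commuting with $\tau$ (not assumed onto). **Graphs and textile systems.** A graph is a finite directed graph $G$ (multiple arcs, loops allowed) with arc-set $A_G$, vertex-set $V_G$ and initial/terminal vertex maps $i_G,t_G$; $X_G\subset A_G^{\mathbb Z}$ is the set of bi-infinite paths. A graph-homomorphism $h=(h_A,h_V):\Gamma\to G$ is a pair of maps on arcs and vertices compatible with $i,t$; it induces $\phi_h:X_\Gamma\to X_G$, $(\alpha_j)\mapsto(h_A(\alpha_j))$. $h$ is weakly left-resolving (resp. weakly right-resolving) if every arc $\alpha$ of $\Gamma$ is uniquely determined by $t_\Gamma(\alpha)$ (resp. $i_\Gamma(\alpha)$) and $h_A(\alpha)$. A textile system $T=(p,q:\Gamma\to G)$ is a pair of graph-homomorphisms $p,q:\Gamma\to G$. It is weakly $p$-L, $p$-R, $q$-L,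 $q$-R if respectively $p$ is weakly left-resolving, $p$ is weakly right-resolving, $q$ is weakly left-resolving, $q$ is weakly right-resolving. Weakly LR means weakly $p$-L and $q$-R; weakly RL: weakly $p$-R and $q$-L; weakly LL: weakly $p$-L and $q$-L; weakly RR: weakly $p$-R and $q$-R; weakly $p$-biresolving: weakly $p$-L and $p$-R; weakly $q$-biresolving: weakly $q$-L and $q$-R. **Resolving endomorphisms.** An endomorphism $\varphi$ of a subshift $(X,\sigma)$ is weakly $\mathcal P$ if there are a weakly $\mathcal P$ textile system $T=(p,q:\Gamma\to G)$ and a closed shift-invariant $Z\subset X_\Gamma$ such that $\phi_p|_Z$ is injective, $\phi_p(Z)=X$, $\phi_q(Z)\subset X$ and $\varphi=\phi_q\circ(\phi_p|_Z)^{-1}$. For a homeomorphism $\tau$ of a compact metric space $X$, an endomorphism $\varphi$ of $(X,\tau)$ is essentially weakly $\mathcal P$ if there are a subshift $(X',\sigma')$, a weakly $\mathcal P$ endomorphism $\varphi'$ of $(X',\sigma')$ and a homeomorphism $\theta:X\to X'$ with $\theta\tau=\sigma'\theta$, $\theta\varphi=\varphi'\theta$. An endomorphism $\varphi$ of $(X,\sigma)$ is directionally essentially weakly $\mathcal P$ if there exist $r,s\ge1$ such that $\varphi^r$ is an essentially weakly $\mathcal P$ endomorphism of $(X,\sigma^s)$. *)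

(* Defs.v *)
From HB Require Import structures.
From mathcomp Require Import all_boot all_algebra.
From mathcomp Require Import all_classical topology.

Set Implicit Arguments.
Unset Strict Implicit.
Unset Printing Implicit Defensive.

Import GRing.Theory.
Local Open Scope classical_set_scope.
Local Open Scope ring_scope.

(* A dynamical system is given by a subset X of an ambient topological space   *)
(* and self-maps of the ambient space, of which only the restrictions to X     *)
(* matter; X carries the subspace topology, through {within X, continuous _}.  *)

Definition fullshift (A : finType) : topologicalType :=
  {ptws int -> discrete_topology A}.

Definition shift_map (A : finType) (x : fullshift A) : fullshift A :=
  fun j => x (j + 1).

Definition is_subshift (A : finType) (X : set (fullshift A)) : Prop :=
  [/\ (1 < #|A|)%N, closed X & @shift_map A @` X = X].

Definition endomorphism (T : topologicalType) (X : set T) (tau phi : T -> T) :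
    Prop :=
  [/\ {within X, continuous phi},
      phi @` X `<=` X &
      forall x, X x -> phi (tau x) = tau (phi x)].

Definition homeomorphism (T U : topologicalType) (X : set T) (Y : set U)
    (f : T -> U) : Prop :=
  [/\ {within X, continuous f}, f @` X `<=` Y &
      exists g : U -> T,
        [/\ {within Y, continuous g}, g @` Y `<=` X,
            forall x, X x -> g (f x) = x &
            forall y, Y y -> f (g y) = y]].

Record graph := Graph {
  garc : finType;
  gvertex : finType;
  ginit : garc -> gvertex;
  gterm : garc -> gvertex
}.

Definition paths (G : graph) : set (fullshift (garc G)) :=
  [set x | forall j : int, gterm (x j) = ginit (x (j + 1))].

Record graph_hom (Gamma G : graph) := GraphHom {
  arc_map : garc Gamma -> garc G;
  vertex_map : gvertex Gamma -> gvertex G;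
  arc_map_init : forall a, ginit (arc_map a) = vertex_map (ginit a);
  arc_map_term : forall a, gterm (arc_map a) = vertex_map (gterm a)
}.

Definition block_map (A B : finType) (f : A -> B) (x : fullshift A) :
    fullshift B :=
  fun j => f (x j).

Definition path_map (Gamma G : graph) (h : graph_hom Gamma G) :
    fullshift (garc Gamma) -> fullshift (garc G) :=
  block_map (arc_map h).

Definition weakly_left_resolving (Gamma G : graph) (h : graph_hom Gamma G) :
    Prop :=
  forall a b : garc Gamma,
    gterm a = gterm b -> arc_map h a = arc_map h b -> a = b.

Definition weakly_right_resolving (Gamma G : graph) (h : graph_hom Gamma G) :
    Prop :=
  forall a b : garc Gamma,
    ginit a = ginit b -> arc_map h a = arc_map h b -> a = b.

Record textile := Textile {
  tx_dom : graph;
  tx_cod : graph;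
  tx_p : graph_hom tx_dom tx_cod;
  tx_q : graph_hom tx_dom tx_cod
}.

Inductive resolving_term :=
  | PL | PR | QR | QL | LR | RL | LL | RR | Pbi | Qbi.

Definition weakly_textile (P : resolving_term) (T : textile) : Prop :=
  let pL := weakly_left_resolving (tx_p T) in
  let pR := weakly_right_resolving (tx_p T) in
  let qL := weakly_left_resolving (tx_q T) in
  let qR := weakly_right_resolving (tx_q T) in
  match P with
  | PL => pL
  | PR => pR
  | QR => qR
  | QL => qL
  | LR => pL /\ qR
  | RL => pR /\ qL
  | LL => pL /\ qL
  | RR => pR /\ qR
  | Pbi => pL /\ pR
  | Qbi => qL /\ qR
  end.

Definition letters (A : finType) (X : set (fullshift A)) : set A :=
  [set a | exists2 x, X x & exists j : int, x j = a].

(* Here X must be both a subset of A^Z and a set of bi-infinite sequences of   *)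
(* arcs of G.  The map e names the letters occurring in X as arcs of G, so     *)
(* that block_map e @` X is X read as a subset of (garc G)^Z; the unused       *)
(* letters of A need not be arcs of G.                                         *)
Definition weakly (P : resolving_term) (A : finType) (X : set (fullshift A))
    (phi : fullshift A -> fullshift A) : Prop :=
  exists (T : textile) (Z : set (fullshift (garc (tx_dom T))))
         (e : A -> garc (tx_cod T)),
    [/\ weakly_textile P T,
        [/\ closed Z, @shift_map _ @` Z = Z & Z `<=` @paths (tx_dom T)],
        set_inj (letters X) e,
        [/\ set_inj Z (path_map (tx_p T)),
            path_map (tx_p T) @` Z = block_map e @` X &
            path_map (tx_q T) @` Z `<=` block_map e @` X] &
        forall z x, Z z -> X x -> path_map (tx_p T) z = block_map e x ->
          block_map e (phi x) = path_map (tx_q T) z].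

Definition essentially_weakly (P : resolving_term) (T : topologicalType)
    (X : set T) (tau phi : T -> T) : Prop :=
  exists (A' : finType) (X' : set (fullshift A'))
         (phi' : fullshift A' -> fullshift A') (theta : T -> fullshift A'),
    [/\ is_subshift X',
        endomorphism X' (@shift_map A') phi' /\ weakly P X' phi',
        homeomorphism X X' theta,
        forall x, X x -> theta (tau x) = shift_map (theta x) &
        forall x, X x -> theta (phi x) = phi' (theta x)].

Definition directionally_essentially_weakly (P : resolving_term)
    (A : finType) (X : set (fullshift A)) (phi : fullshift A -> fullshift A) :
    Prop :=
  exists r s : nat,
    [/\ (1 <= r)%N, (1 <= s)%N &
        essentially_weakly P X (iter s (@shift_map A)) (iter r phi)].

(* Main.v *)
Require Import Defs.
From mathcomp Require Import all_boot all_algebra.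
From mathcomp Require Import all_classical topology.

Set Implicit Arguments.
Unset Strict Implicit.
Unset Printing Implicit Defensive.

Import GRing.Theory.
Local Open Scope classical_set_scope.
Local Open Scope ring_scope.

(** An endomorphism phi of (X, tau) gives every point x a square, in the manner
    of Wang tiles, once two partitions of X into finitely many clopen sets are
    chosen.  If u names the cell of a point in the first one and w in the second
    one, the square of x has bottom edge u x, top edge u (phi x), left edge w x
    and right edge w (tau x).  In a textile system, an arc of Gamma is such a
    square: its p-label and its q-label are its bottom and top, its initial and
    terminal vertices are its left and right.  The four conditions weakly p-L,
    p-R, q-L and q-R then say that a square is determined by two adjacent edges,
    namely by bottom and right, bottom and left, top and right, or top and left.
    So each of the ten resolving terms asks that the corners in a certain set
    determine the squares.

    This makes being essentially weakly P a property of the pair (tau, phi) which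
    mentions neither textile systems nor subshifts: there are a generating clopen
    partition u and a clopen partition w for which the corners listed by P
    determine the squares (square_coding).  One direction pulls the partitions
    back along the conjugacy, w being the initial vertex of the arc at place 0;
    the inverse of the injective map induced by p is continuous by compactness,
    so w is clopen (square_coding_of_essentially_weakly).  For the other
    direction, the squares that occur are taken as the arcs of Gamma, and the
    points of X are recoded by their u-itineraries
    (essentially_weakly_of_square_coding).

    With this characterization the theorem is a short computation.  Let u and w
    be partitions that work for phi^r and tau^s.  For phi and tau, let U x be the
    block u x, u (phi x), .., u (phi^(r-1) x) and let W x be the block
    w x, w (tau x), .., w (tau^(s-1) x).  The bottom U x and the top U (phi x)
    share all entries but the first one of the bottom, u x, and the last one of
    the top, u (phi^r x); likewise the left and the right differ by w x and
    w (tau^s x).  These four exceptional entries are the edges of the square of x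
    for phi^r and tau^s.  A corner of the new square contains the same corner of
    the old one, hence determines all four exceptional entries, hence the whole
    new square (resolving_squares_orbit_block).  The same U and W serve for all
    corners at once, which is why conditions on two corners cause no extra
    difficulty. *)

(** * Continuity and locally constant maps *)

Section Continuity.
Context {T U : topologicalType}.

Lemma within_continuous_comp_sub (V : topologicalType) (X : set T) (Y : set U)
    (f : T -> U) (g : U -> V) :
  {within X, continuous f} -> f @` X `<=` Y -> {within Y, continuous g} ->
  {within X, continuous (g \o f)}.
Proof.
move=> /subspace_continuousP cf fXY /subspace_continuousP cg.
apply/subspace_continuousP => x Xx.
have Yfx : Y (f x) by apply: fXY; exists x.
move=> W /(cg _ Yfx) nW.
have nYW : nbhs (f x) (fun y => Y y -> W (g y)) by exact: nW.
have := cf _ Xx _ nYW.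
rewrite !nbhs_simpl /within /=.
by apply: filterS => y h Xy; apply: h => //; apply: fXY; exists y.
Qed.

(** The inverse pulls a closed set A back to the image of the compact set
    X `&` A, which is compact, hence closed. *)
Lemma within_continuous_inverse (X : set T) (f : T -> U) (g : U -> T) :
  hausdorff_space U -> compact X -> {within X, continuous f} ->
  (forall x, X x -> g (f x) = x) -> {within f @` X, continuous g}.
Proof.
move=> hU cX cf fK; apply/continuous_closedP => A clA.
apply/closed_subspaceP; exists (f @` (X `&` A)).
  apply: compact_closed => //; apply: continuous_compact.
    by apply: continuous_subspaceW cf; exact: subIsetl.
  exact: compact_closedI.
apply/seteqP; split=> [y [[x [Xx Ax] <-] _]|y [Ay [x Xx fxy]]].
  by split; [rewrite /preimage /= /from_subspace fK|exists x].
split; last by exists x.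
exists x => //; split=> //; move: Ay.
by rewrite /preimage /= -fxy /from_subspace fK.
Qed.

(** This is continuity on X towards the discrete space B; for finite B, such a
    map is a partition of X into clopen sets with named cells. *)
Definition locally_constant (B : Type) (X : set T) (u : T -> B) : Prop :=
  forall x, X x -> \forall y \near x, X y -> u y = u x.

Lemma locally_constant_post (B C : Type) (X : set T) (u : T -> B) (g : B -> C) :
  locally_constant X u -> locally_constant X (g \o u).
Proof.
by move=> lu x Xx; apply: filterS (lu x Xx) => y h Xy /=; rewrite h.
Qed.

Lemma locally_constant_pair (B C : Type) (X : set T) (u : T -> B) (v : T -> C) :
  locally_constant X u -> locally_constant X v ->
  locally_constant X (fun x => (u x, v x)).
Proof.
move=> lu lv x Xx; apply: filterS2 (lu x Xx) (lv x Xx) => y hu hv Xy.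
by rewrite hu // hv.
Qed.

Lemma locally_constant_ffun (I : finType) (B : Type) (X : set T)
    (u : I -> T -> B) :
  (forall i, locally_constant X (u i)) ->
  locally_constant X (fun x => [ffun i => u i x]).
Proof.
move=> lu x Xx.
have : \forall y \near x, forall i, X y -> u i y = u i x.
  apply: filter_forall => i; exact: lu.
by apply: filterS => y h Xy; apply/ffunP => i; rewrite !ffunE h.
Qed.

End Continuity.

Lemma locally_constant_pre (T U : topologicalType) (B : Type) (X : set T)
    (Y : set U) (f : T -> U) (u : U -> B) :
  {within X, continuous f} -> f @` X `<=` Y -> locally_constant Y u ->
  locally_constant X (u \o f).
Proof.
move=> /subspace_continuousP cf fXY lu x Xx.
have Yfx : Y (f x) by apply: fXY; exists x.
have := cf _ Xx _ (lu _ Yfx); rewrite !nbhs_simpl /within /=.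
by apply: filterS => y h Xy; apply: h => //; apply: fXY; exists y.
Qed.

Lemma within_continuous_iter (T : topologicalType) (X : set T) (f : T -> T) n :
  {within X, continuous f} -> f @` X `<=` X ->
  {within X, continuous (iter n f)} /\ iter n f @` X `<=` X.
Proof.
move=> cf fX; elim: n => [|n [cn nX]].
  split; last by move=> _ [x Xx <-].
  by apply: continuous_subspaceT => x; exact: cvg_id.
split; first exact: (within_continuous_comp_sub cn nX cf).
move=> _ [x Xx <-] /=; apply: fX; exists (iter n f x) => //.
by apply: nX; exists x.
Qed.

(** * The full shift *)

Section Fullshift.
Context {A : finType}.

Lemma hausdorff_fullshift : hausdorff_space (fullshift A).
Proof. by apply: hausdorff_product => i; exact: discrete_hausdorff. Qed.

Lemma compact_fullshift : compact [set: fullshift A].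
Proof.
have cA : compact [set: discrete_topology A].
  apply: (@finite_compact (discrete_topology A)).
  exact: (@finite_finset A setT).
have := @tychonoff int (fun=> discrete_topology A) (fun=> setT) (fun=> cA).
by congr compact; apply/seteqP; split.
Qed.

Lemma closed_compact_fullshift (X : set (fullshift A)) : closed X -> compact X.
Proof. by move=> cX; apply: (subclosed_compact cX compact_fullshift). Qed.

Lemma locally_constant_coord (X : set (fullshift A)) (j : int) :
  locally_constant X (fun x => x j).
Proof.
move=> x _.
have xj : \forall y \near x, y j = x j.
  exact: (@proj_continuous int (fun=> discrete_topology A) j x _
            (discrete_set1 _)).
by apply: filterS xj => y.
Qed.

Lemma within_continuous_fullshift (T : topologicalType) (X : set T)
    (f : T -> fullshift A) :
  (forall j, locally_constant X (fun x => f x j)) -> {within X, continuous f}.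
Proof.
move=> lf; apply/subspace_continuousP => x Xx.
pose Tc (j : int) := Topological.class
  (initial_topology (fun y : int -> discrete_topology A => y j)).
apply: (proj2 (@cvg_sup _ _ Tc _ (f x) _)) => j W [_ [[V oV <-] Vfx VW]].
rewrite nbhs_simpl /within /=.
apply: filterS (lf j x Xx) => y h Xy; apply: VW.
by rewrite -[preimage _ _ _]/(V (f y j)) h.
Qed.

End Fullshift.

Lemma int_step_const (D : Type) (F : int -> D) :
  (forall j, F (j + 1) = F j) -> forall j, F j = F 0.
Proof.
move=> step; elim/int_rect => [//|n IH|n IH]; first by rewrite intS addrC step.
by rewrite -[F (- n.+1%:Z)]step -IH; congr F; rewrite intS opprD addrC addNKr.
Qed.

(** * Squares and their corners *)

(** The pattern shared by the conditions on textile systems and those on squares,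
    so that one implies the other corner by corner; weakly_textile P Tx is
    convertible to an instance of it. *)
Definition resolving (P : resolving_term) (pL pR qL qR : Prop) : Prop :=
  match P with
  | PL => pL
  | PR => pR
  | QR => qR
  | QL => qL
  | LR => pL /\ qR
  | RL => pR /\ qL
  | LL => pL /\ qL
  | RR => pR /\ qR
  | Pbi => pL /\ pR
  | Qbi => qL /\ qR
  end.

Lemma resolving_mono P (pL pR qL qR pL' pR' qL' qR' : Prop) :
  (pL -> pL') -> (pR -> pR') -> (qL -> qL') -> (qR -> qR') ->
  resolving P pL pR qL qR -> resolving P pL' pR' qL' qR'.
Proof. by case: P => /=; tauto. Qed.

Section Squares.
Context {T : Type}.

Definition determines (D E : Type) (X : set T) (f : T -> D) (g : T -> E) :
    Prop :=
  forall x y, X x -> X y -> f x = f y -> g x = g y.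

(** This is injectivity of the two-sided u-itinerary.  Quantifying over full
    orbits in X avoids naming an inverse of tau. *)
Definition generating (B : Type) (X : set T) (tau : T -> T) (u : T -> B) :
    Prop :=
  forall x y : int -> T,
    (forall j, [/\ X (x j), X (y j), tau (x j) = x (j + 1),
                   tau (y j) = y (j + 1) & u (x j) = u (y j)]) ->
    x 0 = y 0.

(** The edges are listed in the order bottom, top, left, right. *)
Definition square (B C : Type) (tau phi : T -> T) (u : T -> B) (w : T -> C)
    (x : T) : B * B * C * C :=
  (u x, u (phi x), w x, w (tau x)).

Lemma square_eq (B C : Type) (tau phi : T -> T) (u : T -> B) (w : T -> C) x y :
  square tau phi u w x = square tau phi u w y ->
  [/\ u x = u y, u (phi x) = u (phi y), w x = w y & w (tau x) = w (tau y)].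
Proof. by case. Qed.

Definition resolving_squares (B C : Type) (P : resolving_term) (X : set T)
    (tau phi : T -> T) (u : T -> B) (w : T -> C) : Prop :=
  let sq := square tau phi u w in
  resolving P
    (determines X (fun x => (u x, w (tau x))) sq)
    (determines X (fun x => (u x, w x)) sq)
    (determines X (fun x => (u (phi x), w (tau x))) sq)
    (determines X (fun x => (u (phi x), w x)) sq).

Definition orbit_block (B : Type) (n : nat) (f : T -> T) (u : T -> B) (x : T) :
    {ffun 'I_n -> B} :=
  [ffun k : 'I_n => u (iter k f x)].

Section OrbitBlock.
Context {B : Type} (n : nat) (f : T -> T) (u : T -> B) (x y : T).
Hypothesis n_gt0 : (0 < n)%N.

Lemma orbit_block_first :
  orbit_block n f u x = orbit_block n f u y -> u x = u y.
Proof. by move=> /ffunP/(_ (Ordinal n_gt0)); rewrite !ffunE. Qed.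

Lemma orbit_block_last :
  orbit_block n f u (f x) = orbit_block n f u (f y) ->
  u (iter n f x) = u (iter n f y).
Proof.
have lt_n : (n.-1 < n)%N by rewrite ltn_predL.
by move=> /ffunP/(_ (Ordinal lt_n)); rewrite !ffunE -!iterSr /= -!iterS prednK.
Qed.

Lemma orbit_block_push :
  u (iter n f x) = u (iter n f y) ->
  orbit_block n f u x = orbit_block n f u y ->
  orbit_block n f u (f x) = orbit_block n f u (f y).
Proof.
move=> un /ffunP uxy; apply/ffunP => k; rewrite !ffunE -!iterSr.
have [lt_k|le_k] := ltnP k.+1 n.
  by have := uxy (Ordinal lt_k); rewrite !ffunE.
by have /eqP -> : k.+1 == n by rewrite eqn_leq le_k ltn_ord.
Qed.

Lemma orbit_block_pull :
  u x = u y ->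
  orbit_block n f u (f x) = orbit_block n f u (f y) ->
  orbit_block n f u x = orbit_block n f u y.
Proof.
move=> u0 /ffunP uxy; apply/ffunP => -[[|k] lt_k]; rewrite !ffunE //=.
by have := uxy (Ordinal (ltnW lt_k)); rewrite !ffunE -!iterSr.
Qed.

End OrbitBlock.

(** A corner of the square of x for the blocks contains the same corner of the
    square of x for u, w, phi^r and tau^s.  The latter square supplies the only
    entries in which opposite edges of the former differ. *)
Lemma resolving_squares_orbit_block (B C : Type) P (X : set T)
    (tau phi : T -> T) (u : T -> B) (w : T -> C) (r s : nat) :
  (0 < r)%N -> (0 < s)%N ->
  resolving_squares P X (iter s tau) (iter r phi) u w ->
  resolving_squares P X tau phi (orbit_block r phi u) (orbit_block s tau w).
Proof.
move=> r0 s0; apply: resolving_mono => det x y Xx Xy [eqU eqW].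
- have [|_ ur w0 _] := square_eq (det x y Xx Xy _).
    by rewrite (orbit_block_first r0 eqU) (orbit_block_last s0 eqW).
  by congr (_, _, _, _) => //;
    [exact: orbit_block_push | exact: orbit_block_pull].
- have [|_ ur _ ws] := square_eq (det x y Xx Xy _).
    by rewrite (orbit_block_first r0 eqU) (orbit_block_first s0 eqW).
  by congr (_, _, _, _) => //; exact: orbit_block_push.
- have [|u0 _ w0 _] := square_eq (det x y Xx Xy _).
    by rewrite (orbit_block_last r0 eqU) (orbit_block_last s0 eqW).
  by congr (_, _, _, _) => //; exact: orbit_block_pull.
- have [|u0 _ _ ws] := square_eq (det x y Xx Xy _).
    by rewrite (orbit_block_last r0 eqU) (orbit_block_first s0 eqW).
  by congr (_, _, _, _) => //;
    [exact: orbit_block_pull | exact: orbit_block_push].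
Qed.

(** Every s-th point of a tau-orbit is a tau^s-orbit, along which the first
    entries of the blocks are u-names. *)
Lemma generating_orbit_block (B : Type) (X : set T) (tau phi : T -> T)
    (u : T -> B) (r s : nat) :
  (0 < r)%N -> generating X (iter s tau) u ->
  generating X tau (orbit_block r phi u).
Proof.
move=> r0 gen x y xy.
have orb (z : int -> T) j n : (forall i, tau (z i) = z (i + 1)) ->
    iter n tau (z j) = z (j + n%:R).
  move=> tz; elim: n => [|n IH]; first by rewrite addr0.
  by rewrite iterS IH tz -natr1 addrA.
have := gen (fun j => x (j * s%:R)) (fun j => y (j * s%:R)).
rewrite mul0r; apply=> j; have [Xx Xy _ _ uxy] := xy (j * s%:R).
rewrite mulrDl mul1r !orb; last 2 first.
- by move=> i; have [] := xy i.
- by move=> i; have [] := xy i.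
by split=> //; exact: orbit_block_first uxy.
Qed.

End Squares.

(** The intrinsic form of being essentially weakly P.  The alphabet of u must
    have two letters because u is to become the coding map of a subshift. *)
Definition square_coding (P : resolving_term) (T : topologicalType)
    (X : set T) (tau phi : T -> T) : Prop :=
  exists (B C : finType) (u : T -> B) (w : T -> C),
    [/\ (1 < #|B|)%N, locally_constant X u, locally_constant X w,
        generating X tau u & resolving_squares P X tau phi u w].

Lemma square_coding_iter P (T : topologicalType) (X : set T)
    (tau phi : T -> T) (r s : nat) :
  {within X, continuous tau} -> tau @` X `<=` X ->
  {within X, continuous phi} -> phi @` X `<=` X ->
  (0 < r)%N -> (0 < s)%N ->
  square_coding P X (iter s tau) (iter r phi) -> square_coding P X tau phi.
Proof.
move=> ct tX cp pX r0 s0 [B [C [u [w [B1 lu lw gen sq]]]]].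
exists {ffun 'I_r -> B}, {ffun 'I_s -> C}.
exists (orbit_block r phi u), (orbit_block s tau w).
split.
- rewrite card_ffun card_ord; exact: leq_trans B1 (leq_pexp2l (ltnW B1) r0).
- apply: locally_constant_ffun => k.
  have [ck kX] := within_continuous_iter k cp pX.
  exact: locally_constant_pre ck kX lu.
- apply: locally_constant_ffun => k.
  have [ck kX] := within_continuous_iter k ct tX.
  exact: locally_constant_pre ck kX lw.
- exact: generating_orbit_block gen.
- exact: resolving_squares_orbit_block sq.
Qed.

(** * From textile systems to squares *)

(** The arc at place 0 of the path zeta x in Z that codes x has labels u x and
    u (phi x) up to the naming e of letters, initial vertex w x and terminal
    vertex w (tau x), since zeta intertwines tau with the shift.  So a corner that
    determines the arcs of Gamma determines the squares. *)
Lemma square_coding_of_essentially_weakly P (T : topologicalType) (X : set T)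
    (tau phi : T -> T) :
  tau @` X `<=` X -> phi @` X `<=` X ->
  essentially_weakly P X tau phi -> square_coding P X tau phi.
Proof.
move=> tauX phiX [A' [X' [phi' [theta [subX' [_ wk] homeo th_tau th_phi]]]]].
have [A'1 _ _] := subX'.
have [X0|[x0 Xx0]] : X = set0 \/ X !=set0.
  by have [->|/set0P] := eqVneq X set0; [left|right].
  (* Gamma may have no vertex at all when X is empty, and then w cannot take
     its values there. *)
  exists bool, unit, (fun=> true), (fun=> tt); split.
  - by rewrite card_bool.
  - by move=> x; rewrite X0.
  - by move=> x; rewrite X0.
  - by move=> x y /(_ 0)[]; rewrite X0.
  - by case: P {wk} => /=; try split; move=> x y; rewrite X0.
case: wk => Tx [Z [e [wt [clZ shZ pathZ] einj [pinj pZ _] act]]].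
case: homeo => ct thX [g [_ _ gK _]].
have thX' x : X x -> X' (theta x) by move=> Xx; apply: thX; exists x.
have tX x : X x -> X (tau x) by move=> Xx; apply: tauX; exists x.
have pX x : X x -> X (phi x) by move=> Xx; apply: phiX; exists x.
have codeZ x : X x -> exists2 z, Z z &
    Defs.path_map (tx_p Tx) z = block_map e (theta x).
  move=> Xx; have : (block_map e @` X') (block_map e (theta x)).
    by exists (theta x) => //; exact: thX'.
  by rewrite -pZ => -[z]; exists z.
have [z0 _ _] := codeZ _ Xx0.
pose lift y := xget z0 [set z | Z z /\ Defs.path_map (tx_p Tx) z = y].
have liftK z : Z z -> lift (Defs.path_map (tx_p Tx) z) = z.
  move=> Zz; rewrite /lift.
  case: xgetP => [z' _ [Zz' pz']|/(_ z)]; last by case.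
  by apply: pinj; rewrite ?inE.
pose zeta x := lift (block_map e (theta x)).
have zetaP x : X x ->
    Z (zeta x) /\ Defs.path_map (tx_p Tx) (zeta x) = block_map e (theta x).
  by move=> /codeZ[z Zz pz]; rewrite /zeta -pz liftK.
have cblock (D E : finType) (f : D -> E) Y :
    {within Y, continuous (block_map f)}.
  apply: within_continuous_fullshift => j.
  exact: (locally_constant_post f (locally_constant_coord j)).
have czeta : {within X, continuous zeta}.
  apply: (within_continuous_comp_sub (Y := Defs.path_map (tx_p Tx) @` Z)
            (f := block_map e \o theta) (g := lift)).
  - exact: (within_continuous_comp_sub ct thX (cblock _ _ e X')).
  - by move=> _ [x Xx <-] /=; have [z Zz <-] := codeZ x Xx; exists z.
  - apply: within_continuous_inverse liftK.
    + exact: hausdorff_fullshift.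
    + exact: closed_compact_fullshift.
    + exact: cblock.
have zeta_tau x : X x -> zeta (tau x) = shift_map (zeta x).
  move=> Xx; have [Zz pz] := zetaP _ Xx; have [Zz' pz'] := zetaP _ (tX _ Xx).
  apply: pinj; rewrite ?inE //; first by rewrite -shZ; exists (zeta x).
  by rewrite pz' th_tau // -[RHS]/(shift_map (Defs.path_map _ _)) pz.
pose u x := theta x 0; pose w x := ginit (zeta x 0).
have eu x : X x -> e (u x) = arc_map (tx_p Tx) (zeta x 0).
  move=> Xx; have [_ pz] := zetaP _ Xx.
  by rewrite -[e _]/(block_map e (theta x) 0) -pz.
have eu_phi x : X x -> e (u (phi x)) = arc_map (tx_q Tx) (zeta x 0).
  move=> Xx; have [Zz pz] := zetaP _ Xx.
  have := act _ _ Zz (thX' _ Xx) pz; rewrite -th_phi //.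
  exact: (congr1 (fun y => y 0)).
have w_tau x : X x -> w (tau x) = gterm (zeta x 0).
  by move=> Xx; rewrite /w zeta_tau //; have [/pathZ/(_ 0)] := zetaP _ Xx.
have u_letter x : X x -> letters X' (u x).
  by move=> Xx; exists (theta x); [exact: thX' | exists 0].
have eu_inj x y : X x -> X y -> e (u x) = e (u y) -> u x = u y.
  by move=> Xx Xy; apply: einj; rewrite inE; exact: u_letter.
have arc_square x y : X x -> X y -> zeta x 0 = zeta y 0 ->
    square tau phi u w x = square tau phi u w y.
  move=> Xx Xy xy; congr (_, _, _, _).
  - by apply: eu_inj; rewrite // !eu // xy.
  - by apply: eu_inj; rewrite ?eu_phi ?xy //; exact: pX.
  - by rewrite /w xy.
  - by rewrite !w_tau // xy.
exists A', (gvertex (tx_dom Tx)), u, w; split=> //.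
- exact: (locally_constant_pre ct thX (locally_constant_coord 0)).
- apply: (locally_constant_post (@ginit _) (u := fun x => zeta x 0)).
  exact: (locally_constant_pre czeta (@subsetT _ _) (locally_constant_coord 0)).
- move=> x y xy.
  have orb (v : int -> T) : (forall j, X (v j) /\ tau (v j) = v (j + 1)) ->
      forall k, theta (v 0) k = u (v k).
    move=> vP k; pose F j := theta (v j) (k - j).
    have Fstep j : F (j + 1) = F j.
      have [Xv tv] := vP j; rewrite /F -tv th_tau // /shift_map.
      by rewrite opprD addrA subrK.
    by rewrite -[k in LHS]subr0 -[LHS](int_step_const Fstep k) /F subrr.
  have [Xx Xy _ _ _] := xy 0.
  rewrite -(gK _ Xx) -(gK _ Xy); congr g; apply/funext => k.
  rewrite !orb; first by have [] := xy k.
  + by move=> j; have [] := xy j.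
  + by move=> j; have [] := xy j.
- move: wt; rewrite -[weakly_textile P Tx]/(resolving P _ _ _ _).
  by apply: resolving_mono => res x y Xx Xy [eqU eqW]; apply: arc_square => //;
    apply: res; rewrite -?w_tau // -?eu // -?eu_phi // eqU.
Qed.

(** * The textile system of the occurring squares *)

Section SquareTextile.
Context {T : Type} {B C : finType} (P : resolving_term) (X : set T)
  (tau phi : T -> T) (u : T -> B) (w : T -> C).

(** Only the squares of points of X become arcs: a corner need not determine a
    quadruple of edges that does not occur. *)
Definition realised (q : B * B * C * C) : bool :=
  `[< exists2 x, X x & square tau phi u w x = q >].

Lemma realised_square x : X x -> realised (square tau phi u w x).
Proof. by move=> Xx; apply/asboolP; exists x. Qed.

Definition square_arc x (Xx : X x) : {q | realised q} :=
  exist realised _ (realised_square Xx).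

Definition square_graph : graph :=
  @Graph {q | realised q} C (fun a => (val a).1.2) (fun a => (val a).2).

(** With a single vertex, all sequences of letters are paths, and the only
    condition on p and q is the one about corners. *)
Definition bouquet : graph := @Graph B unit (fun=> tt) (fun=> tt).

Definition square_bottom : graph_hom square_graph bouquet :=
  @GraphHom square_graph bouquet (fun a => (val a).1.1.1) (fun=> tt)
    (fun=> erefl) (fun=> erefl).

Definition square_top : graph_hom square_graph bouquet :=
  @GraphHom square_graph bouquet (fun a => (val a).1.1.2) (fun=> tt)
    (fun=> erefl) (fun=> erefl).

Definition square_textile : textile := Textile square_bottom square_top.

(** A corner of an arc is the corner of the square of a point, so that what it
    determines for points it determines for arcs. *)
Lemma weakly_square_textile :
  resolving_squares P X tau phi u w -> weakly_textile P square_textile.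
Proof.
rewrite -[weakly_textile _ _]/(resolving P _ _ _ _).
by apply: resolving_mono => det [a ra] [b rb] /= eqw equ; apply: val_inj => /=;
  move: (ra) (rb) => /asboolP[x Xx xa] /asboolP[y Xy yb];
  move: eqw equ; rewrite -xa -yb /= => eqw equ;
  apply: det => //; congr (_, _).
Qed.

End SquareTextile.

(** * Itineraries *)

Definition shift_by (A : finType) (n : int) (x : fullshift A) : fullshift A :=
  fun j => x (j + n).

Section ShiftBy.
Context {A : finType}.
Implicit Types x : fullshift A.

Lemma shift_by0 x : shift_by 0 x = x.
Proof. by apply/funext => j; rewrite /shift_by addr0. Qed.

Lemma shift_by_shift n x : shift_by n (shift_map x) = shift_by (n + 1) x.
Proof. by apply/funext => j; rewrite /shift_by /shift_map addrA. Qed.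

Lemma shift_shift_by n x : shift_map (shift_by n x) = shift_by (n + 1) x.
Proof. by apply/funext => j; rewrite /shift_by /shift_map addrA addrAC. Qed.

Lemma shift_inj : injective (@shift_map A).
Proof.
move=> x y xy; apply/funext => j.
by have := congr1 (fun z => z (j - 1)) xy; rewrite /shift_map subrK.
Qed.

Lemma within_continuous_shift_by (X : set (fullshift A)) n :
  {within X, continuous (shift_by n)}.
Proof.
apply: within_continuous_fullshift => j.
exact: (locally_constant_coord (j + n)).
Qed.

Lemma shift_by_mem (X : set (fullshift A)) n x :
  @shift_map A @` X = X -> X x -> X (shift_by n x).
Proof.
move=> shX Xx.
have -> : X (shift_by n x) = X (shift_by 0 x); last by rewrite shift_by0.
apply: (int_step_const (F := fun n => X (shift_by n x))) => {}n.
rewrite -shift_shift_by; apply/propext; split=> [|Xn]; last first.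
  by rewrite -shX; exists (shift_by n x).
by rewrite -{1}shX => -[y Xy /shift_inj <-].
Qed.

Lemma endomorphism_shift_by (X : set (fullshift A)) phi n x :
  @shift_map A @` X = X -> endomorphism X (@shift_map A) phi -> X x ->
  phi (shift_by n x) = shift_by n (phi x).
Proof.
move=> shX [_ _ comm] Xx.
pose F m := shift_by (n - m) (phi (shift_by m x)).
have Fstep m : F (m + 1) = F m.
  rewrite /F -shift_shift_by comm; last exact: shift_by_mem.
  by rewrite shift_by_shift opprD addrA subrK.
by have := int_step_const Fstep n; rewrite /F subrr subr0 !shift_by0.
Qed.

End ShiftBy.

Definition itinerary (A : finType) (D : Type) (v : fullshift A -> D)
    (x : fullshift A) : int -> D :=
  fun j => v (shift_by j x).

Section Itinerary.
Context {A D : finType} {X : set (fullshift A)} (v : fullshift A -> D).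
Hypotheses (closedX : closed X) (shiftX : @shift_map A @` X = X).
Hypothesis locv : locally_constant X v.
Let code : fullshift A -> fullshift D := itinerary v.

Lemma itinerary_shift x : code (shift_map x) = shift_map (code x).
Proof. by apply/funext => j; rewrite /code /itinerary shift_by_shift. Qed.

Lemma within_continuous_itinerary : {within X, continuous code}.
Proof.
apply: within_continuous_fullshift => j.
apply: (locally_constant_pre (within_continuous_shift_by (n := j)) _ locv).
by move=> _ [x Xx <-]; exact: shift_by_mem.
Qed.

Lemma closed_itinerary_image : closed (code @` X).
Proof.
apply: compact_closed; first exact: hausdorff_fullshift.
apply: continuous_compact; first exact: within_continuous_itinerary.
exact: closed_compact_fullshift.
Qed.

Lemma shift_itinerary_image : @shift_map D @` (code @` X) = code @` X.
Proof.
rewrite -{2}shiftX; apply/seteqP; split.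
  by move=> _ [_ [x Xx <-] <-]; exists (shift_map x);
    [exists x | rewrite itinerary_shift].
by move=> _ [_ [x Xx <-] <-]; exists (code x);
  [exists x | rewrite itinerary_shift].
Qed.

Lemma itinerary_inj : generating X (@shift_map A) v ->
  forall x y, X x -> X y -> code x = code y -> x = y.
Proof.
move=> gen x y Xx Xy xy; rewrite -(shift_by0 x) -(shift_by0 y).
apply: (gen (fun j => shift_by j x) (fun j => shift_by j y)) => j.
rewrite !shift_shift_by; split=> //; try exact: shift_by_mem.
exact: (congr1 (fun z => z j) xy).
Qed.

End Itinerary.

(** * From squares to textile systems *)

Section Recoding.
Context {P : resolving_term} {A B C : finType} {X : set (fullshift A)}
  {phi : fullshift A -> fullshift A} {u : fullshift A -> B}
  {w : fullshift A -> C}.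
Hypotheses (subX : is_subshift X) (endo : endomorphism X (@shift_map A) phi).
Hypotheses (locu : locally_constant X u) (locw : locally_constant X w).
Hypothesis gen : generating X (@shift_map A) u.
Let closedX : closed X := let: And3 _ h _ := subX in h.
Let shiftX : @shift_map A @` X = X := let: And3 _ _ h := subX in h.
Let sq : fullshift A -> B * B * C * C := square (@shift_map A) phi u w.
Let Tx : textile := square_textile X (@shift_map A) phi u w.
Let edges : garc (tx_dom Tx) -> (B * B * C * C)%type := val.

(** Written as the preimage of the image of X under the code by squares, so that
    compactness of X gives its closedness. *)
Definition square_paths : set (fullshift (garc (tx_dom Tx))) :=
  block_map edges @^-1` (itinerary sq @` X).

Lemma square_pathsP z :
  square_paths z -> exists2 x, X x & forall j, edges (z j) = itinerary sq x j.
Proof. by move=> [x Xx xz]; exists x => // j; rewrite xz. Qed.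

Lemma square_path_of x :
  X x -> exists2 z, square_paths z & forall j, edges (z j) = itinerary sq x j.
Proof.
move=> Xx.
exists (fun j => square_arc _ phi u w (shift_by_mem j shiftX Xx)) => //.
by exists x.
Qed.

Lemma edges_inj (z z' : fullshift (garc (tx_dom Tx))) :
  (forall j, edges (z j) = edges (z' j)) -> z = z'.
Proof. by move=> zz'; apply/funext => j; exact: val_inj. Qed.

Lemma locally_constant_square : locally_constant X sq.
Proof.
have [cphi phiX _] := endo.
rewrite /sq /square; do 3?[apply: locally_constant_pair => //].
- exact: locally_constant_pre cphi phiX locu.
- apply: locally_constant_pre locw; last by rewrite shiftX.
  exact: (within_continuous_shift_by (n := 1)).
Qed.

Lemma closed_square_paths : closed square_paths.
Proof.
suff /continuous_closedP cval : continuous (block_map edges).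
  apply: cval; apply: closed_itinerary_image => //.
  exact: locally_constant_square.
apply/continuous_subspace_setT/within_continuous_fullshift => j.
exact: (locally_constant_post edges (locally_constant_coord j)).
Qed.

Lemma shift_square_paths : @shift_map _ @` square_paths = square_paths.
Proof.
apply/seteqP; split.
  move=> _ [z [x Xx xz] <-]; exists (shift_map x).
    by rewrite -shiftX; exists x.
  by rewrite itinerary_shift xz.
move=> z /square_pathsP[x + zx]; rewrite -{1}shiftX => -[y Xy yx].
have [z' Zz' z'y] := square_path_of Xy; exists z' => //.
by apply: edges_inj => j; rewrite zx -yx itinerary_shift; exact: z'y.
Qed.

Lemma square_paths_paths : square_paths `<=` @paths (tx_dom Tx).
Proof.
move=> z /square_pathsP[x Xx zx] j.
rewrite -[LHS]/((edges (z j)).2) -[RHS]/((edges (z (j + 1))).1.2) !zx.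
by rewrite /itinerary /= shift_shift_by.
Qed.

Lemma bottom_square_path z x : (forall j, edges (z j) = itinerary sq x j) ->
  Defs.path_map (tx_p Tx) z = itinerary u x.
Proof.
by move=> zx; apply/funext => j; rewrite -[LHS]/((edges (z j)).1.1.1) zx.
Qed.

Lemma top_square_path z x :
  X x -> (forall j, edges (z j) = itinerary sq x j) ->
  Defs.path_map (tx_q Tx) z = itinerary u (phi x).
Proof.
move=> Xx zx; apply/funext => j; rewrite -[LHS]/((edges (z j)).1.1.2) zx.
by rewrite /itinerary /sq /square /= (endomorphism_shift_by _ shiftX endo).
Qed.

(** The paths of squares are covered injectively by their bottom rows because u
    is generating, and the top row over the itinerary of x is that of phi x. *)
Lemma weakly_itinerary (phi' : fullshift B -> fullshift B) :
  resolving_squares P X (@shift_map A) phi u w ->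
  (forall x, X x -> phi' (itinerary u x) = itinerary u (phi x)) ->
  weakly P (itinerary u @` X : set (fullshift B)) phi'.
Proof.
move=> res phi'E; have [_ phiX _] := endo.
have block_id (x : fullshift B) : block_map id x = x by [].
have inj := itinerary_inj shiftX gen.
exists Tx, square_paths, id; split.
- exact: weakly_square_textile.
- split; [exact: closed_square_paths | exact: shift_square_paths |].
  exact: square_paths_paths.
- by move=> a b _ _.
- split.
  + move=> z z'; rewrite !inE.
    move=> /square_pathsP[x Xx zx] /square_pathsP[x' Xx' zx'].
    rewrite (bottom_square_path zx) (bottom_square_path zx') => xx'.
    by apply: edges_inj => j; rewrite zx zx' (inj _ _ Xx Xx' xx').
  + apply/seteqP; split.
      move=> _ [z /square_pathsP[x Xx zx] <-]; rewrite (bottom_square_path zx).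
      by exists (itinerary u x) => //; exists x.
    move=> _ [_ [x Xx <-] <-]; have [z Zz zx] := square_path_of Xx.
    by exists z => //; exact: bottom_square_path.
  + move=> _ [z /square_pathsP[x Xx zx] <-]; rewrite (top_square_path Xx zx).
    exists (itinerary u (phi x)) => //; exists (phi x) => //.
    by apply: phiX; exists x.
- move=> z _ /square_pathsP[x Xx zx] [x' Xx' <-].
  rewrite (bottom_square_path zx) block_id => /(inj _ _ Xx Xx') <-.
  by rewrite block_id phi'E // (top_square_path Xx zx).
Qed.

End Recoding.

(** Recoding by u-itineraries is a conjugacy onto a subshift: it is injective
    because u is generating, and its inverse is continuous by compactness. *)
Lemma essentially_weakly_of_square_coding P (A : finType)
    (X : set (fullshift A)) (phi : fullshift A -> fullshift A) :
  is_subshift X -> endomorphism X (@shift_map A) phi ->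
  square_coding P X (@shift_map A) phi ->
  essentially_weakly P X (@shift_map A) phi.
Proof.
move=> subX endo [B [C [u [w [B1 lu lw gen res]]]]].
have [A1 clX shX] := subX; have [cphi phiX comm] := endo.
have Xphi x : X x -> X (phi x) by move=> Xx; apply: phiX; exists x.
have Xshift x : X x -> X (shift_map x) by move=> Xx; rewrite -shX; exists x.
pose theta : fullshift A -> fullshift B := itinerary u.
have ctheta : {within X, continuous theta}.
  exact: within_continuous_itinerary.
have theta_shift x : theta (shift_map x) = shift_map (theta x).
  exact: itinerary_shift.
have [a0 _] : exists a : A, true by case/card_gt0P: (ltnW A1) => a; exists a.
pose g y : fullshift A :=
  xget ((fun=> a0) : fullshift A) [set x | X x /\ theta x = y].
have thetaK x : X x -> g (theta x) = x.
  move=> Xx; rewrite /g; case: xgetP => [z _ [Xz zx]|/(_ x)]; last by case.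
  exact: (itinerary_inj shX gen).
have cg : {within theta @` X, continuous g}.
  apply: within_continuous_inverse thetaK => //.
    exact: hausdorff_fullshift.
  exact: closed_compact_fullshift.
have gX : g @` (theta @` X) `<=` X by move=> _ [_ [x Xx <-] <-]; rewrite thetaK.
pose phi' := theta \o phi \o g.
have phi'_theta x : X x -> phi' (theta x) = theta (phi x).
  by move=> Xx; rewrite /phi' /= thetaK.
exists B, (theta @` X), phi', theta; split=> //.
- split=> //; first exact: closed_itinerary_image.
  exact: shift_itinerary_image.
- split; last exact: (weakly_itinerary subX endo lu lw gen res).
  split.
  + apply: within_continuous_comp_sub cg gX _.
    exact: within_continuous_comp_sub cphi phiX ctheta.
  + move=> _ [_ [x Xx <-] <-]; rewrite phi'_theta //.
    by exists (phi x) => //; exact: Xphi.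
  + move=> _ [x Xx <-]; rewrite -theta_shift !phi'_theta //; last exact: Xshift.
    by rewrite comm // theta_shift.
- split=> //; exists g; split=> //.
  by move=> _ [x Xx <-]; rewrite thetaK.
- by move=> x Xx; rewrite phi'_theta.
Qed.

Theorem theorem12p2 (P : resolving_term) (A : finType) (X : set (fullshift A))
    (phi : fullshift A -> fullshift A)
    (hX : is_subshift X) (hphi : endomorphism X (@shift_map A) phi) :
  directionally_essentially_weakly P X phi <->
  essentially_weakly P X (@shift_map A) phi.
Proof.
split=> [[r [s [r0 s0 ew]]]|ew]; last by exists 1%N, 1%N; split.
have [_ _ shX] := hX; have [cphi phiX _] := hphi.
have sX : @shift_map A @` X `<=` X by rewrite shX.
have csh : {within X, continuous (@shift_map A)}.
  exact: (within_continuous_shift_by (n := 1)).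
apply: essentially_weakly_of_square_coding => //.
apply: (square_coding_iter csh sX cphi phiX r0 s0).
apply: square_coding_of_essentially_weakly ew.
- by have [] := within_continuous_iter s csh sX.
- by have [] := within_continuous_iter r cphi phiX.
Qed.
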